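(* Let $(V, V^+,e)$ be an AOU space. If $(W, \{C_n\}_{n=1}^\infty)$ is a matrix ordered $*$-vector space and $\phi : W \to \operatorname{OMIN}(V)$ is a positive linear map (that is, $\phi(C_1)\subseteq V^+$), then $\phi$ is completely positive. Moreover, if $\tilde{V} = (V,\{\tilde{C}_n\}_{n=1}^\infty,e)$ is an operator system with $\tilde{C}_1 = V^+$ and such that for every operator system $W$, any positive linear map $\psi : W\rightarrow\tilde{V}$ is completely positive, then the identity map is a unital complete order isomorphism between $\tilde{V}$ and $\operatorname{OMIN}(V)$.
   Context: A $*$-vector space is a complex vector space $V$ with a conjugate-linear involution $*$; $V_h=\{v: v^*=v\}$. An ordered $*$-vector space $(V,V^+)$ has a cone $V^+\subseteq V_h$ (closed under sums and nonnegative real multiples) with $V^+\cap -V^+=\{0\}$; $v\ge w$ means $v-w\in V^+$. An order unit is $e\in V_h$ such that for each $v\in V_h$ there is $r>0$ with $re\ge v$; it is Archimedean if $v\in V$ and $re+v\ge0$ for all $r>0$ imply $v\in V^+$. An AOU space $(V,V^+,e)$ is an ordered $*$-vector space with an Archimedean order unit. $M_n(V)$ carries the involution $(a_{i,j})^*=(a_{j,i}^* )$. A matrix ordering on $V$ is a family $\{C_n\}_{n\ge1}$ of cones $C_n\subseteq M_n(V)_h$ with $C_n\cap -C_n=\{0\}$ and $X^*C_nX\subseteq C_m$ for all $X\in M_{n,m}(\mathbb{C})$; then $(V,\{C_n\})$ is a matrix ordered $*$-vector space. An operator system is a triple $(V,\{C_n\},e)$ with $\{C_n\}$ a matrix ordering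 and $e\in V_h$ an Archimedean matrix order unit, i.e. $e_n=\operatorname{diag}(e,\dots,e)\in M_n(V)$ is an Archimedean order unit for $(M_n(V),C_n)$ for each $n$. A linear map $\phi$ between matrix ordered spaces is completely positive if $\phi_n((v_{i,j}))=(\phi(v_{i,j}))$ maps the $n$-th cone into the $n$-th cone for every $n$; a complete order isomorphism is an invertible $\phi$ with $\phi$ and $\phi^{-1}$ completely positive. $\operatorname{OMIN}(V)=(V,\{C_n^{\min}(V)\}_{n=1}^\infty,e)$, where $C_n^{\min}(V)=\{(v_{i,j})\in M_n(V):\sum_{i,j=1}^n\overline{\lambda_i}\lambda_jv_{i,j}\in V^+\text{ for all }\lambda_1,\dots,\lambda_n\in\mathbb{C}\}$; this is an operator system. *)

(* Defs.v *)
From HB Require Import structures.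
From mathcomp Require Import all_boot all_order all_algebra.
From mathcomp Require Import complex.
From mathcomp Require Import boolp classical_sets reals.

Set Implicit Arguments.
Unset Strict Implicit.
Unset Printing Implicit Defensive.

Import Order.TTheory GRing.Theory Num.Theory.

Local Open Scope classical_set_scope.
Local Open Scope ring_scope.

(* MathComp gives 'M[K]_n a module structure only over the ring K itself; this
   alias carries the entrywise K-module structure of M_n(V) for a module V. *)
Definition mxmod (K : pzRingType) (V : lmodType K) (n : nat) : Type := 'M[V]_n.

Section MxMod.
Variables (K : pzRingType) (V : lmodType K) (n : nat).

HB.instance Definition _ := GRing.Zmodule.copy (mxmod V n) 'M[V]_n.

Definition mxmod_scale (a : K) (A : mxmod V n) : mxmod V n :=
  map_mx (fun v => a *: v) (A : 'M[V]_n).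

Fact mxmod_scaleA a b A :
  mxmod_scale a (mxmod_scale b A) = mxmod_scale (a * b) A.
Proof. by apply/matrixP => i j; rewrite !mxE scalerA. Qed.

Fact mxmod_scale1 : left_id 1 mxmod_scale.
Proof. by move=> A; apply/matrixP => i j; rewrite !mxE scale1r. Qed.

Fact mxmod_scaleDr : right_distributive mxmod_scale +%R.
Proof. by move=> a A B; apply/matrixP => i j; rewrite !mxE scalerDr. Qed.

Fact mxmod_scaleDl A : {morph mxmod_scale^~ A : a b / a + b}.
Proof. by move=> a b; apply/matrixP => i j; rewrite !mxE scalerDl. Qed.

HB.instance Definition _ := GRing.Zmodule_isLmodule.Build K (mxmod V n)
  mxmod_scaleA mxmod_scale1 mxmod_scaleDr mxmod_scaleDl.

End MxMod.

Section OrderedStarSpaces.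
Variables (R : realType) (V : lmodType R[i]).

Record star_involution (star : V -> V) : Prop := StarInvolution {
  star_semilinear : forall (a : R[i]) (u v : V),
    star (a *: u + v) = a^* *: star u + star v;
  starK : involutive star
}.

Definition hermitian (star : V -> V) : set V := [set v | star v = v].

(* Nonemptiness of the cone is part of cone_proper. *)
Record proper_cone (star : V -> V) (P : set V) : Prop := ProperCone {
  cone_hermitian : P `<=` hermitian star;
  cone_add : forall u v, P u -> P v -> P (u + v);
  cone_scale : forall (r : R) v, 0 <= r -> P v -> P ((r%:C)%C *: v);
  cone_proper : P `&` [set v | P (- v)] = [set 0]
}.

Record archimedean_order_unit (star : V -> V) (P : set V) (e : V) : Prop :=
  ArchimedeanOrderUnit {
    unit_hermitian : hermitian star e;
    unit_dominates : forall v, hermitian star v ->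
      exists2 r : R, 0 < r & P ((r%:C)%C *: e - v);
    unit_archimedean : forall v,
      (forall r : R, 0 < r -> P ((r%:C)%C *: e + v)) -> P v
  }.

Record aou_space (star : V -> V) (P : set V) (e : V) : Prop := AOUSpace {
  aou_star : star_involution star;
  aou_cone : proper_cone star P;
  aou_unit : archimedean_order_unit star P e
}.

Definition mxstar (star : V -> V) (n : nat) (A : mxmod V n) : mxmod V n :=
  (map_mx star (A : 'M[V]_n))^T.

(* X^* A X *)
Definition compression (n m : nat) (X : 'M[R[i]]_(n, m)) (A : 'M[V]_n) :
    'M[V]_m :=
  \matrix_(k, l) \sum_(i < n) \sum_(j < n) ((X i k)^* * X j l) *: A i j.

End OrderedStarSpaces.

Section MatrixOrderedSpaces.
Variables (R : realType) (V : lmodType R[i]).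

(* Families of cones are indexed by all n : nat, but every condition concerns
   n >= 1 only; the component at n = 0 plays no role. *)
Record matrix_ordered_space (star : V -> V) (C : forall n, set 'M[V]_n) :
    Prop := MatrixOrderedSpace {
  mos_star : star_involution star;
  mos_cone : forall n, (0 < n)%N ->
    @proper_cone R (mxmod V n) (@mxstar R V star n) (C n);
  mos_compression : forall n m (X : 'M[R[i]]_(n, m)) (A : 'M[V]_n),
    (0 < n)%N -> (0 < m)%N -> C n A -> C m (compression X A)
}.

(* In M_n(V), e%:M is the diagonal matrix diag(e, ..., e). *)
Record operator_system (star : V -> V) (C : forall n, set 'M[V]_n) (e : V) :
    Prop := OperatorSystem {
  os_matrix_ordered : matrix_ordered_space star C;
  os_unit_hermitian : hermitian star e;
  os_matrix_unit : forall n, (0 < n)%N ->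
    @archimedean_order_unit R (mxmod V n) (@mxstar R V star n) (C n)
      (e%:M : 'M[V]_n)
}.

(* C_1 as a subset of V, through the identification M_1(V) = V. *)
Definition level1 (C : forall n, set 'M[V]_n) : set V :=
  [set v | C 1%N (const_mx v)].

Definition omin (P : set V) (n : nat) : set 'M[V]_n :=
  [set A | forall lam : 'I_n -> R[i],
    P (\sum_(i < n) \sum_(j < n) ((lam i)^* * lam j) *: A i j)].

End MatrixOrderedSpaces.

Section Maps.
Variables (R : realType) (V W : lmodType R[i]).

Definition positive_map (P : set V) (Q : set W) (phi : {linear V -> W}) : Prop :=
  phi @` P `<=` Q.

Definition completely_positive (C : forall n, set 'M[V]_n)
    (D : forall n, set 'M[W]_n) (phi : {linear V -> W}) : Prop :=
  forall n (A : 'M[V]_n), (0 < n)%N -> C n A -> D n (map_mx phi A).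

End Maps.

Section CompleteOrderIsomorphisms.
Variables (R : realType) (V W : lmodType R[i]).

Definition complete_order_iso (C : forall n, set 'M[V]_n)
    (D : forall n, set 'M[W]_n) (phi : {linear V -> W}) : Prop :=
  exists psi : {linear W -> V},
    [/\ cancel phi psi, cancel psi phi,
        completely_positive C D phi & completely_positive D C psi].

Definition unital_complete_order_iso (C : forall n, set 'M[V]_n) (e : V)
    (D : forall n, set 'M[W]_n) (f : W) (phi : {linear V -> W}) : Prop :=
  complete_order_iso C D phi /\ phi e = f.

End CompleteOrderIsomorphisms.

(* Main.v *)
(* Compressing a matrix A of C_n by a column lam puts the quadratic form of A
   at lam into C_1, so a positive map into V sends C_n into omin n. For the
   second part OMIN(V) is shown to be an operator system: then the identity
   OMIN(V) -> V~ is positive, hence completely positive by hypothesis, and its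
   inverse is completely positive by the first part. Properness of the cones
   of OMIN(V) and hermiticity of their elements follow by polarization. The
   matrix order unit dominates a hermitian A because each real part
   t w + (t w)^*, with t = conj(a) b and w an entry of A, is bounded by a
   multiple of max(|a|^2, |b|^2) e. *)

Require Import Defs.
From mathcomp Require Import all_boot all_order all_algebra.
From mathcomp Require Import complex.
From mathcomp Require Import boolp classical_sets reals.
From mathcomp Require Import ring.

Import Order.TTheory GRing.Theory Num.Theory.

Local Open Scope classical_set_scope.
Local Open Scope ring_scope.

(** * Quadratic forms of matrices over V, and polarization *)

Section SesquilinearForm.
Context {R : realType} {V : lmodType R[i]} {n : nat}.
Implicit Types (lam : 'I_n -> R[i]) (A B : 'M[V]_n).

(** This is lam^* A lam, the expression quantified over in [omin]; folding it there lets additivity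
    and polarization act on membership. *)
Definition qform lam A : V :=
  \sum_(i < n) \sum_(j < n) ((lam i)^* * lam j) *: A i j.

Lemma qformD lam A B : qform lam (A + B) = qform lam A + qform lam B.
Proof.
rewrite -big_split; apply: eq_bigr => i _; rewrite -big_split.
by apply: eq_bigr => j _; rewrite mxE scalerDr.
Qed.

Lemma qformZ lam a A : qform lam (a *: (A : mxmod V n)) = a *: qform lam A.
Proof.
rewrite scaler_sumr; apply: eq_bigr => i _; rewrite scaler_sumr.
by apply: eq_bigr => j _; rewrite mxE !scalerA mulrC.
Qed.

Lemma qformN lam A : qform lam (- A) = - qform lam A.
Proof.
rewrite -sumrN; apply: eq_bigr => i _; rewrite -sumrN.
by apply: eq_bigr => j _; rewrite mxE scalerN.
Qed.

Lemma qform_scalar lam (e : V) :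
  qform lam (e%:M) = (\sum_i (lam i)^* * lam i) *: e.
Proof.
rewrite scaler_suml; apply: eq_bigr => i _; rewrite (bigD1 i) //= big1 ?addr0.
  by rewrite mxE eqxx mulr1n.
by move=> j ji; rewrite mxE eq_sym (negbTE ji) mulr0n scaler0.
Qed.

(** Polarization: the form is expanded at d_k + c d_l, with d_k the coordinate vectors, and c takes
    the values 0, 1 and 'i. *)
Lemma qform_eq0 A : (forall lam, qform lam A = 0) -> A = 0.
Proof.
move=> A0.
pose d (k i : 'I_n) : R[i] := (i == k)%:R.
have sumd k (F : 'I_n -> V) : \sum_i d k i *: F i = F k.
  rewrite (bigD1 k) //= big1 ?addr0 /d ?eqxx ?scale1r // => i /negbTE ->.
  by rewrite scale0r.
have conjd k i : (d k i)^* = d k i by rewrite /d rmorph_nat.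
have polar k l c :
    A k k + c *: A k l + c^* *: A l k + (c^* * c) *: A l l = 0.
  rewrite -(A0 (fun i => d k i + c * d l i)) /qform.
  (* The column index is summed first, which leaves columns k and l of A. *)
  transitivity (\sum_i (d k i + c^* * d l i) *: (A i k + c *: A i l)).
    under eq_bigr do rewrite scalerDl -scalerA.
    rewrite big_split /= -scaler_sumr !sumd scalerDr scalerA.
    by rewrite !addrA.
  apply: eq_bigr => i _; rewrite rmorphD rmorphM /= !conjd.
  rewrite -[A i k](sumd k (A i)) -[A i l](sumd l (A i)).
  rewrite scaler_sumr -big_split scaler_sumr; apply: eq_bigr => j _ /=.
  by rewrite [c *: _]scalerA -scalerDl scalerA.
have diag k : A k k = 0.
  by have := polar k k 0; rewrite conjC0 mul0r !scale0r !addr0.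
apply/matrixP => k l; rewrite mxE.
(* c = 1 gives A k l = - A l k; then c = 'i gives 2 'i A l k = 0. *)
have := polar k l 1; rewrite !diag conjC1 mulr1 !scale1r add0r !addr0.
move/eqP; rewrite addr_eq0 => /eqP kl.
have := polar k l 'i; rewrite !diag scaler0 add0r !addr0 conjCi kl.
rewrite scalerN scaleNr -opprD -scalerDl => /eqP.
rewrite oppr_eq0 scaler_eq0 -mulr2n mulrn_eq0 /= (negbTE (neq0Ci _)) /= => /eqP ->.
by rewrite oppr0.
Qed.

End SesquilinearForm.

(** From lam^* (X^* A X) lam = (X lam)^* A (X lam); it makes [omin] stable under compression. *)
Lemma qform_compression {R : realType} {V : lmodType R[i]} {n m : nat}
    (X : 'M[R[i]]_(n, m)) (A : 'M[V]_n) (lam : 'I_m -> R[i]) :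
  qform lam (compression X A) = qform (fun i => \sum_k X i k * lam k) A.
Proof.
rewrite /qform.
under eq_bigr do under eq_bigr do rewrite mxE scaler_sumr.
under eq_bigr do rewrite exchange_big /=.
rewrite exchange_big /=; apply: eq_bigr => i _.
under eq_bigr do under eq_bigr do rewrite scaler_sumr.
under eq_bigr do rewrite exchange_big /=.
rewrite exchange_big /=; apply: eq_bigr => j _.
rewrite rmorph_sum mulr_suml scaler_suml; apply: eq_bigr => k _.
rewrite mulr_sumr scaler_suml; apply: eq_bigr => l _.
by rewrite scalerA rmorphM; congr (_ *: _); ring.
Qed.

(** * Conjugate-linearity of the involution *)

Section StarInvolution.
Context {R : realType} {V : lmodType R[i]} {star : V -> V}.
Hypothesis hstar : star_involution star.

Lemma starD u v : star (u + v) = star u + star v.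
Proof. by have := star_semilinear hstar 1 u v; rewrite conjC1 !scale1r. Qed.

Lemma star0 : star 0 = 0.
Proof. by apply: (addrI (star 0)); rewrite -starD !addr0. Qed.

Lemma starZ a v : star (a *: v) = a^* *: star v.
Proof. by have := star_semilinear hstar a v 0; rewrite star0 !addr0. Qed.

Lemma starN v : star (- v) = - star v.
Proof. by rewrite -scaleN1r starZ rmorphN /= conjC1 scaleN1r. Qed.

Lemma star_sum (I : Type) (r : seq I) (F : I -> V) :
  star (\sum_(i <- r) F i) = \sum_(i <- r) star (F i).
Proof. exact: (big_morph star starD star0). Qed.

Lemma star_qform n (lam : 'I_n -> R[i]) (A : 'M[V]_n) :
  star (qform lam A) = qform lam (mxstar star (A : mxmod V n)).
Proof.
rewrite /qform star_sum.
under eq_bigr do rewrite star_sum.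
rewrite exchange_big /=.
apply: eq_bigr => i _; apply: eq_bigr => j _.
by rewrite starZ !mxE rmorphM /= conjCK mulrC.
Qed.

End StarInvolution.

(** * Closure properties of proper cones *)

Section ProperCone.
Context {R : realType} {V : lmodType R[i]} {star : V -> V} {P : set V}.
Hypothesis hP : proper_cone star P.

Lemma cone0 : P 0.
Proof.
have : (P `&` [set v | P (- v)]) 0 by rewrite (cone_proper hP).
by case.
Qed.

Lemma cone_sum (I : Type) (r : seq I) (F : I -> V) :
  (forall i, P (F i)) -> P (\sum_(i <- r) F i).
Proof.
move=> PF; elim/big_ind: _ => [|u v|i _]; [exact: cone0|exact: cone_add hP u v|].
exact: PF.
Qed.

Lemma cone_scaleC (z : R[i]) v : 0 <= z -> P v -> P (z *: v).
Proof.
(* In the order of R[i], 0 <= z forces z to be real. *)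
move=> z0; have -> : z = ((complex.Re z)%:C)%C by rewrite RRe_real ?ger0_real.
by apply: cone_scale hP _ _ _; move: z0; rewrite lecE => /andP[].
Qed.

Lemma cone_eq0 v : P v -> P (- v) -> v = 0.
Proof.
move=> Pv PNv; have : (P `&` [set v | P (- v)]) v by [].
by rewrite (cone_proper hP).
Qed.

End ProperCone.

(** * OMIN(V) is an operator system *)

Section AOUSpace.
Context {R : realType} {V : lmodType R[i]} {star : V -> V} {P : set V} {e : V}.
Hypothesis hV : aou_space star P e.
Let hstar := aou_star hV.
Let hP := aou_cone hV.
Let hu := aou_unit hV.

Lemma two_sided_bound u : Defs.hermitian star u ->
  exists2 r : R, 0 < r & P ((r%:C)%C *: e - u) /\ P ((r%:C)%C *: e + u).
Proof.
move=> hu1.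
have hu2 : Defs.hermitian star (- u).
  by rewrite /Defs.hermitian /= (starN hstar) hu1.
have [r r0 Pr] := unit_dominates hu hu1.
have [s s0 Ps] := unit_dominates hu hu2.
(* Dominating the hermitian vector 0 puts some q e with q > 0 in P; rescaling reaches every t e. *)
have Pe (t : R) : 0 <= t -> P ((t%:C)%C *: e).
  move=> t0; apply: cone_scale hP _ _ t0 _.
  have h0 : Defs.hermitian star 0 := star0 hstar.
  have [q q0] := unit_dominates hu h0; rewrite subr0 => Pq.
  have := cone_scale hP (ltW (etrans (invr_gt0 q) q0)) Pq.
  by rewrite scalerA -rmorphM mulVf ?gt_eqF // scale1r.
exists (r + s); first exact: addr_gt0.
rewrite rmorphD scalerDl; split.
  by rewrite addrAC; apply: (cone_add hP) => //; exact/Pe/ltW.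
rewrite -addrA; apply: (cone_add hP); first exact/Pe/ltW.
by rewrite -[X in _ + X]opprK.
Qed.

(** The vector is a combination of f - u and f + u with coefficients (s + p)/2 and (s - p)/2, both
    nonnegative, hence real. *)
Lemma scaled_bound f u (p s : R[i]) :
  P (f - u) -> P (f + u) -> - s <= p <= s -> P (s *: f - p *: u).
Proof.
move=> Pm Pp /andP[sp ps].
have -> : s *: f - p *: u
    = 2^-1 *: ((s + p) *: (f - u)) + 2^-1 *: ((s - p) *: (f + u)).
  rewrite !scalerA !scalerBr !scalerDr.
  rewrite addrACA -scalerDl -scaleNr -[- (_ *: u)]scaleNr -scalerDl.
  by congr (_ *: _ + _ *: _); field.
have h0 : 0 <= 2^-1 :> R[i] by rewrite invr_ge0 ler0n.
apply: (cone_add hP); apply: (cone_scaleC hP) => //; apply: (cone_scaleC hP) => //.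
  by rewrite addrC -[s]opprK subr_ge0.
by rewrite subr_ge0.
Qed.

Lemma off_diagonal_bound w : exists2 r : R, 0 < r &
  forall a b s : R[i], a^* * a <= s -> b^* * b <= s ->
  P ((s * (r%:C)%C) *: e - ((a^* * b) *: w + star ((a^* * b) *: w))).
Proof.
(* Hermitian parts: w = u1 + 'i *: u2. *)
pose u1 := 2^-1 *: (w + star w); pose u2 := (2^-1 * - 'i) *: (w - star w).
have starNw : star (- star w) = - w.
  by rewrite (starN hstar) (starK hstar).
have h1 : Defs.hermitian star u1.
  rewrite /Defs.hermitian /= (starZ hstar) (starD hstar) (starK hstar) addrC.
  by rewrite fmorphV rmorph_nat.
have h2 : Defs.hermitian star u2.
  rewrite /Defs.hermitian /= (starZ hstar) (starD hstar) starNw -opprB.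
  rewrite rmorphM fmorphV rmorph_nat rmorphN /= conjCi opprK scalerN -scaleNr.
  by rewrite /u2 mulrN.
have [r1 r10 [P1m P1p]] := two_sided_bound u1 h1.
have [r2 r20 [P2m P2p]] := two_sided_bound u2 h2.
(* Each u_k lies between -r_k e and r_k e, and its coefficient between -2s and 2s. *)
exists (2 * (r1 + r2)); first by rewrite mulr_gt0 ?addr_gt0.
move=> a b s has hbs; set t := a^* * b.
have ii : 'i * 'i = -1 :> R[i] by rewrite -expr2 sqrCi.
have conjt : t^* = b^* * a by rewrite rmorphM /= conjCK mulrC.
(* Expand |a + z b|^2 >= 0 and |a - z b|^2 >= 0. *)
have bound (z : R[i]) : z^* * z = 1 ->
    - (2 * s) <= z * t + z^* * t^* <= 2 * s.
  move=> zz.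
  have sq (x : R[i]) : 0 <= x^* * x by rewrite mulrC mul_conjC_ge0.
  have hs : a^* * a + b^* * b <= 2 * s by rewrite mulr_natl mulr2n lerD.
  have e1 : (a + z * b)^* * (a + z * b)
      = a^* * a + b^* * b + (z * t + z^* * t^*).
    rewrite rmorphD rmorphM /= conjt -[b^* * b]mul1r -zz /t; ring.
  have e2 : (a - z * b)^* * (a - z * b)
      = a^* * a + b^* * b - (z * t + z^* * t^*).
    rewrite rmorphB rmorphM /= conjt -[b^* * b]mul1r -zz /t; ring.
  apply/andP; split.
    rewrite -subr_ge0 opprK addrC; apply: le_trans (sq (a + z * b)) _.
    by rewrite e1 lerD2r.
  rewrite -subr_ge0; apply: le_trans (sq (a - z * b)) _.
  by rewrite e2 lerD2r.
(* z = 1 bounds the coefficient of u1, z = 'i that of u2. *)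
have b1 := bound 1; rewrite conjC1 !mul1r in b1.
have b2 := bound 'i; rewrite conjCi !mulNr ii opprK in b2.
have -> : (s * ((2 * (r1 + r2))%:C)%C) *: e - (t *: w + star (t *: w))
    = ((2 * s) *: ((r1%:C)%C *: e) - (t + t^*) *: u1)
      + ((2 * s) *: ((r2%:C)%C *: e) - ('i * t - 'i * t^*) *: u2).
  rewrite addrACA -opprD !scalerA -scalerDl; congr (_ - _).
    by rewrite rmorphM rmorph_nat rmorphD; congr (_ *: _); ring.
  rewrite (starZ hstar) !scalerDr scalerN -scaleNr addrACA -!scalerDl.
  congr (_ *: _ + _ *: _).
    (* [ring] treats 'i as an atom, so 'i * 'i is isolated and replaced by -1 separately. *)
    transitivity (2^-1 * (t + t^*) - 2^-1 * ('i * 'i) * (t - t^*)); last by ring.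
    by rewrite ii; field.
  transitivity (2^-1 * (t + t^*) + 2^-1 * ('i * 'i) * (t - t^*)); last by ring.
  by rewrite ii; field.
by apply: (cone_add hP); apply: scaled_bound => //; [exact: b1|exact: b2].
Qed.

Lemma omin_cone n : @proper_cone R (mxmod V n) (@mxstar R V star n) (@omin R V P n).
Proof.
split.
- move=> A PA; apply/eqP; rewrite -subr_eq0; apply/eqP.
  apply: qform_eq0 => lam; rewrite qformD qformN -(star_qform hstar).
  by rewrite (cone_hermitian hP (PA lam)) subrr.
- move=> A B PA PB lam; rewrite -/(qform lam (A + B)) qformD.
  exact: (cone_add hP) (PA lam) (PB lam).
- move=> r A r0 PA lam.
  rewrite -/(qform lam ((r%:C)%C *: A)) qformZ.
  exact: (cone_scale hP) r0 (PA lam).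
apply/seteqP; split=> A.
  case=> PA PNA; apply: qform_eq0 => lam; apply: (cone_eq0 hP).
    exact: PA lam.
  by have := PNA lam; rewrite -/(qform lam (- A)) qformN.
have P0 : omin P (0 : 'M[V]_n).
  move=> lam; rewrite big1 => [|i _]; first exact: (cone0 hP).
  by rewrite big1 // => j _; rewrite mxE scaler0.
by move=> ->; split => //=; rewrite oppr0.
Qed.

Lemma omin_unit n : (0 < n)%N -> @archimedean_order_unit R (mxmod V n)
  (@mxstar R V star n) (@omin R V P n) (e%:M : 'M[V]_n).
Proof.
move=> n0.
have sq (x : R[i]) : 0 <= x^* * x by rewrite mulrC mul_conjC_ge0.
split.
- apply/matrixP => i j; rewrite !mxE eq_sym.
  by case: eqP => _; rewrite ?mulr1n ?mulr0n ?(unit_hermitian hu) ?(star0 hstar).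
- move=> A hA.
  have bound (k : 'I_n * 'I_n) : exists r : R, 0 < r /\
      forall a b s : R[i], a^* * a <= s -> b^* * b <= s ->
      P ((s * (r%:C)%C) *: e -
        ((a^* * b) *: A k.1 k.2 + star ((a^* * b) *: A k.1 k.2))).
    by have [r r0 hr] := off_diagonal_bound (A k.1 k.2); exists r.
  have [r hr] := choice bound.
  (* Summing the bounds over all index pairs dominates Q + Q^* = 2 Q, where Q is the form of the
     hermitian A; hence the half. *)
  pose M := 2^-1 * \sum_k r k.
  exists M.
    rewrite mulr_gt0 ?invr_gt0 //.
    (* Strict positivity of M needs one index pair, supplied by 0 < n. *)
    rewrite (bigD1 (Ordinal n0, Ordinal n0)) //= ltr_pwDl ?(hr _).1 //.
    by apply: sumr_ge0 => k _; exact: ltW (hr k).1.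
  move=> lam; rewrite -/(qform lam (_ - _)) qformD qformN.
  rewrite qformZ qform_scalar; set s := \sum_i _.
  (* The squared norm s of lam bounds every |lam i|^2, so the same s fits every pair. *)
  have ls i : (lam i)^* * lam i <= s.
    by rewrite /s (bigD1 i) //= lerDl sumr_ge0.
  have hQ : star (qform lam A) = qform lam A by rewrite (star_qform hstar) hA.
  have Qpair : qform lam A = \sum_k ((lam k.1)^* * lam k.2) *: A k.1 k.2.
    by rewrite /qform pair_bigA.
  have : P (\sum_k ((s * ((r k)%:C)%C) *: e -
      (((lam k.1)^* * lam k.2) *: A k.1 k.2
       + star (((lam k.1)^* * lam k.2) *: A k.1 k.2)))).
    by apply: (cone_sum hP) => k; apply: (hr k).2.
  rewrite big_split /= sumrN big_split /= -(star_sum hstar) -Qpair hQ.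
  rewrite -scaler_suml -mulr_sumr -rmorph_sum.
  have h0 : 0 <= 2^-1 :> R[i] by rewrite invr_ge0 ler0n.
  move=> /(cone_scaleC hP _ _ h0); congr P.
  rewrite scalerBr !scalerA /M; congr (_ - _).
    by rewrite rmorphM fmorphV rmorph_nat; congr (_ *: _); ring.
  by rewrite -mulr2n -[X in _ *: X]scaler_nat scalerA mulVf ?scale1r ?pnatr_eq0.
- move=> A hA lam; rewrite -/(qform lam A).
  have {}hA (r : R) : 0 < r ->
      P (((r%:C)%C * \sum_i (lam i)^* * lam i) *: e + qform lam A).
    by move=> /hA /(_ lam); rewrite -/(qform lam (_ + _)) qformD qformZ
      qform_scalar scalerA.
  move: hA; set s := \sum_i _ => hA.
  have s0 : 0 <= s by apply: sumr_ge0.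
  have sE : s = ((complex.Re s)%:C)%C by rewrite RRe_real ?ger0_real.
  (* The form of r e_n + A is r s e + Q. If s = 0 it is already Q; otherwise r / s is used for r and
     the Archimedean property of e applies. *)
  have [s00|sn0] := eqVneq s 0.
    by have := hA 1 ltr01; rewrite s00 mulr0 scale0r add0r.
  have s1 : 0 < complex.Re s.
    by have : 0 < s; [rewrite lt0r sn0|rewrite {1}sE ltcR].
  apply: (unit_archimedean hu) => r r0.
  have := hA _ (divr_gt0 r0 s1).
  by rewrite {2}sE -rmorphM divfK ?gt_eqF.
Qed.

Lemma omin_operator_system : operator_system star (omin P) e.
Proof.
split; [split|exact: unit_hermitian hu|exact: omin_unit].
- exact: hstar.
- by move=> n _; exact: omin_cone.
- move=> n m X A _ _ PA lam.
  rewrite -/(qform lam (compression X A)) qform_compression.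
  exact: PA.
Qed.

Lemma level1_omin : level1 (omin P) `<=` P.
Proof.
by move=> v /(_ (fun=> 1)); rewrite !big_ord1 conjC1 mulr1 mxE scale1r.
Qed.

End AOUSpace.

(** By linearity the form of phi_n(A) at lam is phi of the form of A at lam, and the latter is the
    entry of the 1 x 1 compression of A by the column lam. *)
Lemma omin_completely_positive {R : realType} {V W : lmodType R[i]}
    {Vp : set V} {starW : W -> W} {C : forall n, set 'M[W]_n}
    {phi : {linear W -> V}} :
  matrix_ordered_space starW C -> positive_map (level1 C) Vp phi ->
  completely_positive C (omin Vp) phi.
Proof.
move=> hC hphi n A n0 CA lam; apply: hphi; exists (qform lam A).
  have := mos_compression hC (\col_i lam i) n0 (ltn0Sn 0) CA.
  congr (C _ _); apply/matrixP => k l; rewrite !mxE.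
  by apply: eq_bigr => i _; apply: eq_bigr => j _; rewrite !mxE.
rewrite linear_sum; apply: eq_bigr => i _; rewrite linear_sum.
by apply: eq_bigr => j _; rewrite linearZ mxE.
Qed.

Theorem theorem3p4 (R : realType) (V : lmodType R[i]) (star : V -> V)
    (Vp : set V) (e : V) (hV : aou_space star Vp e) :
  (forall (W : lmodType R[i]) (starW : W -> W) (C : forall n, set 'M[W]_n)
      (phi : {linear W -> V}),
    matrix_ordered_space starW C ->
    positive_map (level1 C) Vp phi ->
    completely_positive C (omin Vp) phi)
  /\
  (forall Ct : forall n, set 'M[V]_n,
    operator_system star Ct e ->
    level1 Ct = Vp ->
    (forall (W : lmodType R[i]) (starW : W -> W) (D : forall n, set 'M[W]_n)
        (eW : W) (psi : {linear W -> V}),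
      operator_system starW D eW ->
      positive_map (level1 D) (level1 Ct) psi ->
      completely_positive D Ct psi) ->
    unital_complete_order_iso Ct e (omin Vp) e (idfun : {linear V -> V})).
Proof.
split=> [W starW C phi|Ct hCt Ct1 univ]; first exact: omin_completely_positive.
split=> //; exists idfun; split=> //.
  apply: omin_completely_positive (os_matrix_ordered hCt) _.
  by rewrite Ct1 => _ [v Pv <-].
(* The hypothesis on V~ is applied with OMIN(V) itself as the source. *)
apply: univ (omin_operator_system hV) _.
by rewrite Ct1 => _ [v Pv <-]; exact: level1_omin.
Qed.
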